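(* Let $n\in\mathbb{N}$ and let $X\subseteq\mathbb{N}$ be a finite set with $\min X\ge 3$. If $X$ is $\omega^{300n}$-large, then $X$ is $\mathrm{RT}^{2}_{2}$-$\omega^{n}$-large: for every colouring $P:[X]^2\to 2$ there is an $\omega^n$-large set $Y\subseteq X$ that is $P$-homogeneous.
   Context: Ordinals $\alpha<\omega^\omega$ are written in Cantor normal form $\alpha=\omega^{n_0}+\dots+\omega^{n_{k-1}}$ with $n_0\ge\dots\ge n_{k-1}$; $1=\omega^0$ and $\omega^n\cdot k$ denotes the sum of $k$ copies of $\omega^n$. For $m\in\mathbb{N}$ define $0[m]=0$, $(\beta+1)[m]=\beta$, and $(\beta+\omega^{n})[m]=\beta+\omega^{n-1}\cdot m$ for $n\ge 1$ (where $\beta+\omega^n$ is in Cantor normal form). A finite set $X=\{x_0<\dots<x_{\ell-1}\}\subseteq\mathbb{N}$ is $\alpha$-large if $\alpha[x_0][x_1]\cdots[x_{\ell-1}]=0$. A finite set $X$ is $\mathrm{RT}^2_2$-$\alpha$-large if for every $P:[X]^2\to 2$ there is an $\alpha$-large $P$-homogeneous $Y\subseteq X$. *)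

(* Defs.v *)
From mathcomp Require Import all_boot.
Set Implicit Arguments. Unset Strict Implicit. Unset Printing Implicit Defensive.

(* An ordinal alpha < omega^omega in Cantor normal form
   alpha = omega^{n_0} + ... + omega^{n_{k-1}}, n_0 >= ... >= n_{k-1},
   is represented by the list of exponents [:: n_0; ...; n_{k-1}];
   0 is the empty list. *)
Definition cnf := seq nat.

Definition cnf_ok (a : cnf) : bool := sorted geq a.

Definition omega_pow (n : nat) : cnf := [:: n].

(* fundamental sequence alpha[m]:
   0[m] = 0, (beta+1)[m] = beta, (beta + omega^(k+1))[m] = beta + omega^k * m *)
Definition fs (a : cnf) (m : nat) : cnf :=
  match a with
  | [::] => [::]
  | x :: s =>
      let b := belast x s in
      match last x s with
      | 0 => b
      | k.+1 => b ++ nseq m k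
      end
  end.

(* A finite set X = {x_0 < ... < x_{l-1}} is represented by the strictly
   increasing list of its elements. *)
Definition fin_set (X : seq nat) : bool := sorted ltn X.

Definition large (a : cnf) (X : seq nat) : bool := foldl fs a X == [::].

Definition homogeneous (P : nat -> nat -> bool) (Y : seq nat) : Prop :=
  exists c : bool, forall x y, x \in Y -> y \in Y -> x < y -> P x y = c.

Definition RT22_large (a : cnf) (X : seq nat) : Prop :=
  forall P : nat -> nat -> bool,
    exists Y : seq nat,
      [/\ fin_set Y, {subset Y <= X}, large a Y & homogeneous P Y].

(* Main.v *)
Require Import Defs.
From mathcomp Require Import all_boot.
From mathcomp Require Import zify.

Set Implicit Arguments. Unset Strict Implicit. Unset Printing Implicit Defensive.

(** Call [a] a root of colour [c] over a set [Z] if [P a z = c] for all [z] in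
    [Z] (above [a]).  By induction on [p + q], every [omega^(33(p+q))]-large set
    whose minimum is at least about [33(p+q)] has an [omega^p]-large subset of
    colour [true] or an [omega^q]-large subset of colour [false].

    The engine is a grouping lemma: a set that is [omega^(k+12)]-large with
    minimum [w >= k] contains up to [4^w] consecutive [omega^k]-large blocks such
    that [P] is constant on the product of any two of them.  Each block is
    thinned so that the colour of a pair depends neither on its upper point
    within the block nor on its lower one; since the number of constraints is
    elementary in the minimum of the block, this costs a bounded number of
    exponents.

    For the induction step, pick a root [a], of colour [c] say, and group the
    rest into [a] blocks.  If all cross colours are [c], apply the induction
    hypothesis inside each block: either one block contains a large enough set
    of the other colour, or [a] and the [a] sets of colour [c] together are one
    exponent larger.  Otherwise some block [B] lies below a block [B'] with cross
    colour [~~ c], so [a' = min B] is a root of colour [~~ c] over [B'], while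
    [a] is still a root of colour [c] over [B'].  Group [B'] into [2^(a+a')]
    blocks; Ramsey's theorem for these finitely many blocks yields [a] blocks of
    cross colour [c] or [a'] blocks of cross colour [~~ c], and the matching
    root finishes the argument.

    Dropping an initial [omega^N]-large piece makes the minimum exceed [N],
    which is why [n] may be assumed smaller than the elements of the set. *)

(** * Largeness up to passing to subsets *)

(* [big s X]: some subset of [X] is large for the ordinal whose Cantor normal
   form is [rev s]; the head of [s] is the least term, which is consumed first. *)
Inductive big : seq nat -> seq nat -> Prop :=
| big_nil X : big [::] X
| big_skip s x X : big s X -> big s (x :: X)
| big_zero s x X : big s X -> big (0 :: s) (x :: X)
| big_succ n s x X : big (nseq x n ++ s) X -> big (n.+1 :: s) (x :: X).

Lemma fs_rcons s n m :
  fs (rcons s n) m = if n is k.+1 then s ++ nseq m k else s.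
Proof. by case: s => [|x s]; rewrite /fs //= last_rcons belast_rcons. Qed.

Lemma large_big s X : large (rev s) X -> big s X.
Proof.
elim: X s => [|x X IH] [|n s]; rewrite /large; try by move=> _; constructor.
- by move/eqP => /= /(congr1 size); rewrite size_rev.
- rewrite /= rev_cons fs_rcons; case: n => [|n] h.
    by constructor; apply: IH.
  by constructor; apply: IH; rewrite rev_cat rev_nseq.
Qed.

Lemma big_large s X : big s X -> exists2 Y, subseq Y X & large (rev s) Y.
Proof.
elim=> {s X} [X|s x X _ [Y sYX lY]|s x X _ [Y sYX lY]|n s x X _ [Y sYX lY]].
- by exists [::]; rewrite ?sub0seq.
- by exists Y => //; apply: subseq_trans sYX (subseq_cons _ _).
- exists (x :: Y); first by rewrite /= eqxx.
  by rewrite /large /= rev_cons fs_rcons.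
- exists (x :: Y); first by rewrite /= eqxx.
  by rewrite /large /= rev_cons fs_rcons -(rev_nseq x) -rev_cat.
Qed.

Lemma big_subseq s X Y : subseq X Y -> big s X -> big s Y.
Proof.
move=> + h; elim: h Y => {s X} [X|s x X _ IH|s x X _ IH|n s x X _ IH] Y.
- by constructor.
- by move=> sXY; apply/IH/subseq_trans/sXY/subseq_cons.
- elim: Y => [|y Y IHY] //=; case: eqP => [<- sXY|_ sXY].
    by constructor; apply: IH.
  by constructor; apply: IHY.
- elim: Y => [|y Y IHY] //=; case: eqP => [<- sXY|_ sXY].
    by constructor; apply: IH.
  by constructor; apply: IHY.
Qed.

Lemma big_cat s t X Y : big s X -> big t Y -> big (s ++ t) (X ++ Y).
Proof.
move=> + tY; elim=> {s X} [X|s x X _ IH|s x X _ IH|n s x X _ IH] /=.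
- by apply: big_subseq tY; apply: suffix_subseq.
- by constructor.
- by constructor.
- by constructor; rewrite catA.
Qed.

(** The terms of [s] are spent before those of [t], so [Z] is cut where [s] runs out; a successor
    step only replaces the head of the prefix still to be spent. *)
Lemma big_catP s t Z :
  big (s ++ t) Z -> exists X Y, [/\ Z = X ++ Y, big s X & big t Y].
Proof.
move e: (s ++ t) => u h; elim: h s e => {u Z}
  [X|u x X _ IH|u x X h IH|n u x X h IH] s e.
- by case: s e => [|//] /= ->; exists [::], X; split=> //; constructor.
- have [X1 [Y [-> h1 h2]]] := IH _ e.
  by exists (x :: X1), Y; split=> //; constructor.
- case: s e => [/= ->|y s [-> e]].
    by exists [::], (x :: X); split=> //; constructor.
  have [X1 [Y [-> h1 h2]]] := IH _ e.
  by exists (x :: X1), Y; split=> //; constructor.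
- case: s e => [/= ->|y s [-> e]].
    by exists [::], (x :: X); split=> //; constructor.
  have [|X1 [Y [-> h1 h2]]] := IH (nseq x n ++ s); first by rewrite -e catA.
  by exists (x :: X1), Y; split=> //; constructor.
Qed.

Lemma big_succP n X : big [:: n.+1] X ->
  exists X0 x Y, X = X0 ++ x :: Y /\ big (nseq x n) Y.
Proof.
move e: [:: _] => u h; elim: h e => {u X} [//|u x X _ IH e|//|m u x X h _].
  by have [X0 [y [Y [-> hY]]]] := IH e; exists (x :: X0), y, Y.
case=> en eu; exists [::], x, X; split=> //.
by move: h; rewrite -eu cats0 en.
Qed.

Lemma big_nseq_le n k l X : k <= l -> big (nseq l n) X -> big (nseq k n) X.
Proof.
move=> /subnKC <-; rewrite nseqD => /big_catP [Y [Z [-> hY _]]].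
by apply: big_subseq hY; apply: prefix_subseq.
Qed.

Lemma size_big s X : big s X -> size s <= size X.
Proof.
by elim=> {s X} //= [s x X _|n s x X _]; rewrite ?size_cat ?size_nseq; lia.
Qed.

Lemma sorted_cat_lt X Y : sorted ltn (X ++ Y) ->
  [/\ sorted ltn X, sorted ltn Y &
      forall x y, x \in X -> y \in Y -> x < y].
Proof.
rewrite !(sorted_pairwise ltn_trans) pairwise_cat => /and3P [h -> ->].
by split=> // x y hx hy; apply: (allrelP h).
Qed.

Lemma sorted_subseq X Y : subseq X Y -> sorted ltn Y -> sorted ltn X.
Proof. exact: subseq_sorted ltn_trans _ _. Qed.

Lemma sorted_cat_ge w X Y : sorted ltn (X ++ Y) ->
  (forall x, x \in X ++ Y -> w <= x) ->
  forall y, y \in Y -> w + size X <= y.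
Proof.
elim: X w => [|x X IH] w so ge y yY; first by rewrite addn0; apply: ge.
rewrite addnS -addSn; apply: IH yY; first by move: so => /= /path_sorted.
move=> z zXY; apply: (@leq_ltn_trans x); first by apply: ge; rewrite inE eqxx.
by move: so; rewrite /= (path_sortedE ltn_trans) => /andP [/allP/(_ _ zXY)].
Qed.

(** Each term [n.+1] spends one point, which is at least [w] and so releases at least [w] terms
    [n]. *)
Lemma big_nseq_succ n k w X : (forall x, x \in X -> w <= x) ->
  big (nseq k n.+1) X -> big (nseq (k * w) n) X.
Proof.
elim: k X => [|k IH] X ge h; first by constructor.
have [Y [Z [eX hY hZ]]] := big_catP (s := [:: n.+1]) h.
have [Y0 [x [Y1 [eY hY1]]]] := big_succP hY.
rewrite mulSn nseqD eX; apply: big_cat; last first.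
  by apply: IH hZ => z zZ; apply: ge; rewrite eX mem_cat zZ orbT.
have wx : w <= x by apply: ge; rewrite eX eY !mem_cat inE eqxx orbT.
apply: big_nseq_le wx _; apply: big_subseq hY1.
by rewrite eY -cat_rcons suffix_subseq.
Qed.

(** Positivity matters: spending the point 0 on a term [n.+1] would leave no term at all. *)
Lemma big_leq n k X : (forall x, x \in X -> 0 < x) ->
  big [:: n + k] X -> big [:: n] X.
Proof.
move=> X0; elim: k => [|k IH]; first by rewrite addn0.
rewrite addnS => /(big_nseq_succ (k := 1) X0) /IH; exact.
Qed.

Lemma size_big1 n X : (forall x, x \in X -> 0 < x) -> big [:: n] X -> n < size X.
Proof.
elim: n X => [|n IH] X X0 h; first exact: size_big h.
have [Z [x [Y [eX hY]]]] := big_succP h.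
have Y0 y : y \in Y -> 0 < y.
  by move=> yY; apply: X0; rewrite eX mem_cat inE yY !orbT.
have x0 : 0 < x by apply: X0; rewrite eX mem_cat inE eqxx orbT.
have := IH Y Y0 (big_nseq_le (k := 1) x0 hY).
by rewrite eX size_cat /=; lia.
Qed.

(** * Pigeonhole for two-colourings of points *)

Definition side (f : nat -> bool) c X := [seq x <- X | f x == c].

Lemma side_cat f c X Y : side f c (X ++ Y) = side f c X ++ side f c Y.
Proof. exact: filter_cat. Qed.

Definition splits f n d := forall X, sorted ltn X -> big (nseq d n) X ->
  exists c, big [:: n] (side f c X).

(** Cut [X] into [2 * k] pieces, each of which has a large colour class; one colour wins at least
    [k] pieces. *)
Lemma splits_nseq f n d k X : splits f n d -> sorted ltn X ->
  big (nseq (2 * k * d) n) X -> exists c, big (nseq k n) (side f c X).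
Proof.
move=> hs so h.
suff [k1 [k2 [e h1 h2]]] : exists k1 k2, [/\ k1 + k2 = 2 * k,
    big (nseq k1 n) (side f true X) & big (nseq k2 n) (side f false X)].
  have [l|l] := leqP k k1; first by exists true; apply: big_nseq_le h1.
  by exists false; apply: big_nseq_le h2; lia.
move: (2 * k) h so => {}k; elim: k X => [|k IH] X h so.
  by exists 0, 0; split=> //; constructor.
move: h; rewrite mulSn nseqD => /big_catP [Y [Z [eX hY hZ]]].
move: so; rewrite eX => /sorted_cat_lt [sY sZ _].
have [k1 [k2 [e h1 h2]]] := IH _ hZ sZ.
have [[] hc] := hs _ sY hY.
  exists k1.+1, k2; split; rewrite ?side_cat; first by lia.
    exact: (big_cat hc h1).
  by apply: big_subseq h2; apply: suffix_subseq.
exists k1, k2.+1; split; rewrite ?side_cat; first by lia.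
  by apply: big_subseq h1; apply: suffix_subseq.
exact: (big_cat hc h2).
Qed.

(* If both colours occur in the first block, then every later block has its
   least element above a witness of each colour, so the smaller blocks inside
   are numerous enough for whichever colour wins. *)
Lemma splits_expn f n : splits f n (4 ^ n).
Proof.
elim: n => [|n IH] X so h.
  case: X so h => [|x X] so h; first by inversion h.
  exists (f x); rewrite /side /= eqxx.
  by constructor; constructor.
have le : 1 + 2 * 4 ^ n <= 4 ^ n.+1.
  by rewrite expnS; have := expn_gt0 4 n; lia.
have {h le} := big_nseq_le le h.
rewrite nseqD => /big_catP [Y [Z [eX hY hZ]]].
move: so; rewrite eX => /sorted_cat_lt [sY sZ lt].
have mono c : all (fun x => f x == c) Y ->
    exists c, big [:: n.+1] (side f c (Y ++ Z)).
  move=> /all_filterP e; exists c; rewrite side_cat {1}/side e.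
  by apply: big_subseq hY; apply: prefix_subseq.
have wit c : has (fun x => f x == c) Y || all (fun x => f x == ~~ c) Y.
  rewrite -implyNb -all_predC; apply/implyP; apply: sub_all => x /=.
  by case: (f x) c => [] [].
case/orP: (wit true) => [/hasP [y yY fy]|/mono //].
case/orP: (wit false) => [/hasP [z zY fz]|/mono //].
pose w := maxn y z.
have ge x : x \in Z -> w <= x.
  by move=> xZ; rewrite geq_max (ltnW (lt _ _ yY xZ)) (ltnW (lt _ _ zY xZ)).
(* Reordered, these are [2 * w * 4 ^ n] copies, so [w] copies survive in one colour, enough for a
   witness [u <= w] of that colour placed in front. *)
have := big_nseq_succ ge hZ; rewrite mulnAC => hZ'.
have [c hc] := splits_nseq IH sZ hZ'.
have [u [uY /eqP fu uw]] : exists u, [/\ u \in Y, f u == c & u <= w].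
  by case: c {hc}; [exists y|exists z]; split=> //; rewrite /w; lia.
exists c; rewrite side_cat.
apply: (@big_subseq _ (u :: side f c Z)).
  rewrite -cat1s; apply: cat_subseq => //.
  by rewrite sub1seq mem_filter fu eqxx.
by constructor; rewrite cats0; apply: big_nseq_le hc.
Qed.

(** Constraints are imposed one at a time, each dividing the number of copies by [2 * 4 ^ n]. *)
Lemma big_constant (T : eqType) (g : T -> nat -> bool) n (s : seq T) X :
  sorted ltn X -> big (nseq ((2 * 4 ^ n) ^ size s) n) X ->
  exists Y, [/\ subseq Y X, big [:: n] Y &
    forall i, i \in s -> {in Y &, forall x y, g i x = g i y}].
Proof.
elim: s X => [|i s IH] X so h; first by exists X.
move: h; rewrite /= expnSr mulnCA mulnA => h.
have [c hc] := splits_nseq (@splits_expn (g i) n) so h.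
have sub : subseq (side (g i) c X) X by apply: filter_subseq.
have [Y [sY hY cY]] := IH _ (sorted_subseq sub so) hc.
exists Y; split=> //; first exact: subseq_trans sY sub.
move=> j; rewrite inE => /orP [/eqP ->|/cY //] x y.
move=> /(mem_subseq sY); rewrite mem_filter => /andP [/eqP -> _].
by move=> /(mem_subseq sY); rewrite mem_filter => /andP [/eqP -> _].
Qed.

(** * Exponential growth of the number of blocks *)

Lemma leq_double_exp2 t : 2 * t <= 2 ^ t.
Proof. by case: t => // t; rewrite expnS leq_mul2l ltn_expl. Qed.

(** A term [n.+1] occupies at least [w] points, so whatever follows is at least [2 * w]. After [k]
    such doublings the last term is expanded. *)
Lemma big_nseq_double k n w X : sorted ltn X ->
  (forall x, x \in X -> w <= x) -> big (nseq k.+1 n.+1) X ->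
  big (nseq (2 ^ k * w) n) X.
Proof.
elim: k w X => [|k IH] w X so ge h.
  by rewrite expn0; apply: (big_nseq_succ (k := 1)).
have [Y [Z [eX hY hZ]]] := big_catP (s := [:: n.+1]) h.
rewrite eX in so ge *; have geZ := sorted_cat_ge so ge.
have [_ sZ _] := sorted_cat_lt so.
have geY x : x \in Y -> w <= x by move=> xY; rewrite ge ?mem_cat ?xY.
have := size_big (big_nseq_succ (k := 1) geY hY).
rewrite mul1n size_nseq => wY.
rewrite expnSr -mulnA; apply: big_subseq (suffix_subseq Y Z) _.
by apply: IH => // z /geZ; lia.
Qed.

Lemma big_exp2 n w X : 0 < w -> sorted ltn X ->
  (forall x, x \in X -> w <= x) -> big [:: n.+2] X -> big (nseq (2 ^ w) n) X.
Proof.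
move=> w0 so ge /big_succP [X0 [x [Y [eX hY]]]].
rewrite eX -cat_rcons in so ge *; apply: big_subseq (suffix_subseq _ Y) _.
have wx : w <= x by apply: ge; rewrite mem_cat mem_rcons inE eqxx.
have [_ sY lt] := sorted_cat_lt so.
case: x wx hY lt {eX ge so} => [|x] wx hY lt; first by lia.
have ge y : y \in Y -> 2 <= y.
  by move=> yY; have := lt x.+1 y; rewrite mem_rcons inE eqxx yY; lia.
apply: big_nseq_le (big_nseq_double sY ge hY).
by rewrite -expnSr leq_exp2l.
Qed.

(** Two exponents buy one exponential: of [T] copies of [n.+2], all but one serve to raise the
    minimum to [T], and the last expands into [2 ^ T] copies of [n]. *)
Lemma big_tower j n w X : 0 < w -> sorted ltn X ->
  (forall x, x \in X -> w <= x) -> big [:: n + 2 * j.+1] X ->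
  big (nseq (iter j.+1 (expn 2) w) n) X.
Proof.
move=> w0 so ge; elim: j n => [|j IH] n h.
  by apply: big_exp2; rewrite // -addn2.
have {h} : big [:: n.+2 + 2 * j.+1] X by congr (big [:: _] X): h; lia.
move/IH; rewrite [iter j.+2 _ _]iterS; set T := iter j.+1 _ w => h.
have T0 : 0 < T by rewrite /T iterS expn_gt0.
move: h; rewrite -(prednK T0) -addn1 nseqD => /big_catP [Y [Z [eX hY hZ]]].
have := size_big hY; rewrite size_nseq => sY.
rewrite eX in so ge *; have geZ := sorted_cat_ge so ge.
have [_ sZ _] := sorted_cat_lt so.
apply: big_subseq (suffix_subseq Y Z) _.
by apply: big_exp2 => // [|z /geZ]; lia.
Qed.

(** Eight exponents give a tower of four exponentials over [w], which exceeds
    [(2 * 4 ^ n) ^ (2 ^ 2 ^ w)] when [n <= w]. *)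
Lemma big_constant_tower (T : eqType) (g : T -> nat -> bool) n w (s : seq T) X :
  0 < w -> n <= w -> size s <= 2 ^ 2 ^ w -> sorted ltn X ->
  (forall x, x \in X -> w <= x) -> big [:: n + 8] X ->
  exists Y, [/\ subseq Y X, big [:: n] Y &
    forall i, i \in s -> {in Y &, forall x y, g i x = g i y}].
Proof.
move=> w0 nw ss so ge h; apply: (@big_constant T g n s X so).
apply: big_nseq_le (@big_tower 3 n w X w0 so ge h).
rewrite /=; move: ss (ltn_expl w (leqnn 2)); move: (2 ^ w) => t ss wt.
rewrite -[4]/(2 ^ 2) -expnM -expnS -expnM leq_exp2l //.
apply: leq_trans (_ : 2 ^ t * 2 ^ t <= _).
  by apply: leq_mul => //; have := leq_double_exp2 t; lia.
by rewrite -expnD leq_exp2l // addnn -mul2n leq_double_exp2.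
Qed.

(** * Grouping into blocks with constant cross colours *)

Lemma big_blocks n k X : big (nseq k n) X ->
  exists Bs, [/\ size Bs = k, subseq (flatten Bs) X &
    forall B, B \in Bs -> big [:: n] B].
Proof.
elim: k X => [|k IH] X h; first by exists [::]; rewrite sub0seq.
have [Y [Z [-> hY /IH [Bs [sB fB hB]]]]] := big_catP (s := [:: n]) h.
exists (Y :: Bs); split; rewrite /= ?sB ?cat_subseq //.
by move=> B; rewrite inE => /orP [/eqP ->|/hB].
Qed.

Lemma sorted_head_leq B x : sorted ltn B -> x \in B -> head 0 B <= x.
Proof.
case: B => //= b B; rewrite (path_sortedE ltn_trans) inE.
by move=> /andP [/allP h _] /orP [/eqP -> //|/h /ltnW].
Qed.

Lemma big_head n B : big [:: n] B -> head 0 B \in B.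
Proof. by case: B => [/size_big //|b B _]; rewrite inE eqxx. Qed.

Definition cross (P : nat -> nat -> bool) c (B B' : seq nat) :=
  allrel (fun x y => P x y == c) B B'.

Definition crossed P (B B' : seq nat) := cross P true B B' || cross P false B B'.

(** Blocks are thinned from the last to the first. The final conjunct is the invariant: a point
    below all blocks sees each thinned block in one colour. *)
Lemma crossed_blocks P n w Bs : 3 <= w -> n <= w -> size Bs <= 2 ^ (2 * w) ->
  sorted ltn (flatten Bs) -> (forall x, x \in flatten Bs -> w <= x) ->
  (forall B, B \in Bs -> big [:: n + 8] B) ->
  exists Bs', [/\ size Bs' = size Bs, subseq (flatten Bs') (flatten Bs),
    forall B, B \in Bs' -> big [:: n] B, pairwise (crossed P) Bs' &
    forall y, (forall z, z \in flatten Bs -> y < z) ->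
      forall B, B \in Bs' -> {in B &, forall u v, P y u = P y v}].
Proof.
move=> w3 nw; elim: Bs => [|B Bs IH] sB so ge hB; first by exists [::].
move: so; rewrite [flatten _]/= => /sorted_cat_lt [soB soF lt].
have {IH} [|||Bs' [sBs sub hBs pw cst]] := IH _ soF.
- by move: sB => /=; lia.
- by move=> x xF; apply: ge; rewrite /= mem_cat xF orbT.
- by move=> C CB; apply: hB; rewrite inE CB orbT.
pose v := head 0 B.
have vB : v \in B by apply/big_head/hB; rewrite inE eqxx.
have wv : w <= v by apply: ge; rewrite /= mem_cat vB.
pose g (i : bool * nat) x := if i.1 then P i.2 x else P x i.2.
(* All numbers below [v] stand for the points of earlier blocks; by the invariant, one
   representative of each later block suffices. *)
pose s := [seq (true, y) | y <- iota 0 v] ++ [seq (false, head 0 C) | C <- Bs'].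
have ss : size s <= 2 ^ 2 ^ v.
  rewrite size_cat !size_map size_iota sBs.
  apply: leq_trans (_ : 2 ^ (2 * v) + 2 ^ (2 * v) <= _).
    have : 2 ^ (2 * w) <= 2 ^ (2 * v) by rewrite leq_exp2l // leq_mul2l.
    have := ltn_expl (2 * v) (leqnn 2); move: sB => /=; lia.
  rewrite addnn -mul2n -expnS leq_exp2l //.
  case: (v) wv => [|v']; first by lia.
  by have := leq_double_exp2 v'; have := ltn_expl v' (leqnn 2); rewrite expnS; lia.
have [||||Y [sY hY cY]] := @big_constant_tower _ g n v s B _ _ ss soB.
- by lia.
- by lia.
- by move=> x; apply: sorted_head_leq.
- by apply: hB; rewrite inE eqxx.
have cl y : y < v -> {in Y &, forall a b, P y a = P y b}.
  move=> yv; apply: (cY (true, y)); rewrite mem_cat map_f //.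
  by rewrite mem_iota.
have cr C : C \in Bs' -> {in Y &, forall a b, P a (head 0 C) = P b (head 0 C)}.
  move=> CB; apply: (cY (false, head 0 C)); rewrite mem_cat.
  by apply/orP; right; apply/mapP; exists C.
exists (Y :: Bs'); split; rewrite /= ?sBs ?cat_subseq //.
- by move=> C; rewrite inE => /orP [/eqP ->|/hBs].
- rewrite pw andbT; apply/allP => C CB.
  have hC := big_head (hBs _ CB); have hdY := big_head hY.
  suff e x y : x \in Y -> y \in C -> P x y = P (head 0 Y) (head 0 C).
    rewrite /crossed; case E : (P (head 0 Y) (head 0 C)).
      by apply/orP; left; apply/allrelP => x y xY yC; rewrite e // E.
    by apply/orP; right; apply/allrelP => x y xY yC; rewrite e // E.
  move=> xY yC; rewrite -(cr C CB x) //.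
  by apply: (cst x) CB _ _ yC hC => z; apply: lt; apply: mem_subseq xY.
- move=> y lty C; rewrite inE => /orP [/eqP ->|CB].
    by apply: cl; apply: lty; rewrite mem_cat vB.
  by apply: cst CB => z zF; apply: lty; rewrite mem_cat zF orbT.
Qed.

(** Of the 12 exponents, 4 produce [2 ^ 2 ^ w] blocks and 8 pay for thinning them. *)
Lemma grouping P n w M X : 3 <= w -> n <= w -> M <= 2 ^ (2 * w) ->
  sorted ltn X -> (forall x, x \in X -> w <= x) -> big [:: n + 12] X ->
  exists Bs, [/\ size Bs = M, subseq (flatten Bs) X,
    forall B, B \in Bs -> big [:: n] B & pairwise (crossed P) Bs].
Proof.
move=> w3 nw Mw so ge h.
have {}h : big (nseq M (n + 8)) X.
  apply: (big_nseq_le (l := 2 ^ 2 ^ w)).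
    by apply: leq_trans Mw _; rewrite leq_exp2l // leq_double_exp2.
  by apply: (@big_tower 1 (n + 8) w X); rewrite -?addnA //; lia.
have [Bs [sB sub hB]] := big_blocks h.
have [||| Bs' [sB' sub' hB' pw _]] := @crossed_blocks P n w Bs w3 nw _ _ _ hB.
- by rewrite sB.
- exact: sorted_subseq sub so.
- by move=> x /(mem_subseq sub)/ge.
by exists Bs'; split=> //; [rewrite sB'|apply: subseq_trans sub' sub].
Qed.

(** * Finite Ramsey theorem and facts on lists *)

Lemma ramsey_pairwise (T : eqType) (r : rel T) s t (l : seq T) :
  2 ^ (s + t) <= size l ->
  exists2 k, subseq k l & (size k = s /\ pairwise r k) \/
    (size k = t /\ pairwise (fun x y => ~~ r x y) k).
Proof.
move e: (s + t) => m; elim: m s t e l => [|m IH] s t e l.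
  by exists [::]; [exact: sub0seq|left; split=> //=; lia].
case: s e => [|s] e; first by exists [::]; [exact: sub0seq|left].
case: t e => [|t] e; first by exists [::]; [exact: sub0seq|right].
case: l => [|x l] sl; first by move: sl; rewrite leqNgt expn_gt0.
have : size (filter (r x) l) + size (filter (predC (r x)) l) = size l.
  by rewrite !size_filter count_predC.
move: sl; rewrite expnS => /= sl sz.
have [l1|l1] := leqP (2 ^ m) (size (filter (r x) l)).
  have [|k sk] := IH s t.+1 _ _ l1; first by lia.
  have skl := subseq_trans sk (filter_subseq _ _).
  case=> [[sz1 pw]|hk]; last first.
    by exists k; [apply: subseq_trans skl (subseq_cons _ _)|right].
  exists (x :: k); first by rewrite /= eqxx.
  left; split; rewrite /= ?sz1 // pw andbT.
  by apply/allP => y /(mem_subseq sk); rewrite mem_filter => /andP [].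
have l2 : 2 ^ m <= size (filter (predC (r x)) l) by lia.
have [|k sk] := IH s.+1 t _ _ l2; first by lia.
have skl := subseq_trans sk (filter_subseq _ _).
case=> [hk|[sz1 pw]].
  by exists k; [apply: subseq_trans skl (subseq_cons _ _)|left].
exists (x :: k); first by rewrite /= eqxx.
right; split; rewrite /= ?sz1 // pw andbT.
by apply/allP => y /(mem_subseq sk); rewrite mem_filter => /andP [].
Qed.

Lemma subseq_flatten (T : eqType) (l k : seq (seq T)) :
  subseq k l -> subseq (flatten k) (flatten l).
Proof.
elim: l k => [|x l IH] [|y k] //=; first by move=> _; apply: sub0seq.
case: eqP => [-> /IH h|_ /IH h]; first exact: cat_subseq.
exact: subseq_trans h (suffix_subseq _ _).
Qed.

Lemma mem_subseq_flatten (T : eqType) (l : seq (seq T)) B :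
  B \in l -> subseq B (flatten l).
Proof. by rewrite -sub1seq => /subseq_flatten; rewrite /= cats0. Qed.

Lemma mem_or_all (T : eqType) (Q R : T -> Prop) (l : seq T) :
  (forall x, x \in l -> Q x \/ R x) ->
  (exists2 x, x \in l & Q x) \/ forall x, x \in l -> R x.
Proof.
elim: l => [|x l IH] h; first by right.
have [|Qx|Rx] := h x; first by rewrite inE eqxx.
  by left; exists x; rewrite ?inE ?eqxx.
have [y yl|[y yl Qy]|hl] := IH; first by apply: h; rewrite inE yl orbT.
  by left; exists y; rewrite // inE yl orbT.
by right=> y; rewrite inE => /orP [/eqP ->|/hl].
Qed.

Lemma pairwise_orP (T : eqType) (r r' : rel T) (l : seq T) :
  pairwise (fun x y => r x y || r' x y) l ->
  pairwise r l \/ exists x y, subseq [:: x; y] l /\ r' x y.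
Proof.
elim: l => [|x l IH]; first by left.
move=> /= /andP [xl /IH [pw|[u [v [sub ruv]]]]]; last first.
  by right; exists u, v; split=> //; apply: subseq_trans sub (subseq_cons _ _).
have [h|] := boolP (all (r x) l); first by left; rewrite pw.
move=> /allPn [y yl nr]; right; exists x, y; rewrite /= eqxx sub1seq; split=> //.
by move/allP: xl => /(_ y yl); rewrite (negPf nr).
Qed.

(** * Homogeneous sets, by induction on the sum of the two targets *)

Definition hom (P : nat -> nat -> bool) c Y := pairwise (fun x y => P x y == c) Y.

Lemma hom_flatten P c p Bs : pairwise (cross P c) Bs ->
  (forall B, B \in Bs -> exists H, [/\ subseq H B, big [:: p] H & hom P c H]) ->
  exists Y, [/\ subseq Y (flatten Bs), big (nseq (size Bs) p) Y & hom P c Y].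
Proof.
elim: Bs => [|B Bs IH] /=; first by exists [::]; split=> //; constructor.
move=> /andP [cB pw] h.
have [|Y [sY bY hY]] := IH pw; first by move=> C CB; apply: h; rewrite inE CB orbT.
have [|H [sH bH hH]] := h B; first by rewrite inE eqxx.
exists (H ++ Y); split; first exact: cat_subseq.
  exact: (big_cat bH bY).
rewrite /hom pairwise_cat; apply/and3P; split=> //.
apply/allrelP => x y xH /(mem_subseq sY)/flattenP [C CB yC].
have /allrelP := allP cB _ CB; apply=> //; exact: mem_subseq xH.
Qed.

(** The targets [p] and [q] are [t true] and [t false]; indexing them by colour lets both colours be
    treated at once. *)
Definition hom_goal P (t : bool -> nat) X :=
  exists c Y, [/\ subseq Y X, big [:: t c] Y & hom P c Y].

(** Lower the target of [c] by one inside each block. Unless a block already reaches the target of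
    [~~ c], the [a] sets of colour [c] and the root [a] in front regain the lost exponent. *)
Lemma hom_goal_rooted P n m (t : bool -> nat) c a Bs X :
  (forall t' B, t' true + t' false = m -> subseq B X -> big [:: n] B ->
     hom_goal P t' B) ->
  t true + t false = m.+1 -> 0 < t c ->
  subseq (a :: flatten Bs) X -> size Bs = a ->
  (forall B, B \in Bs -> big [:: n] B) -> pairwise (cross P c) Bs ->
  (forall y, y \in flatten Bs -> P a y = c) ->
  hom_goal P t X.
Proof.
move=> IH tm tc sub sz hB pw root.
pose t' b := if b == c then (t c).-1 else t b.
have subX B : B \in Bs -> subseq B X.
  move=> /mem_subseq_flatten h; apply: subseq_trans h _.
  exact: subseq_trans (subseq_cons _ _) sub.
have [B BB|[B BB]|hc] := @mem_or_all _
    (fun B => exists Y, [/\ subseq Y B, big [:: t (~~ c)] Y & hom P (~~ c) Y])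
    (fun B => exists Y, [/\ subseq Y B, big [:: (t c).-1] Y & hom P c Y]) Bs.
- have [|b [Y [sY bY hY]]] := IH t' _ _ (subX _ BB) (hB _ BB).
    by move: tc tm; rewrite /t'; case: (c) => /=; lia.
  move: bY; rewrite /t'; case: eqP => [e bY|/eqP].
    by right; exists Y; split; rewrite // -e.
  move=> bc bY; left; exists Y; have -> : ~~ c = b by case: (c) (b) bc => [] [].
  by split.
- move=> [Y [sY bY hY]]; exists (~~ c), Y; split=> //.
  exact: subseq_trans sY (subX _ BB).
have [Y [sY bY hY]] := hom_flatten pw hc.
exists c, (a :: Y); split.
- by apply: subseq_trans sub; rewrite /= eqxx.
- rewrite -(prednK tc); constructor; rewrite cats0.
  by rewrite -{1}sz.
rewrite /hom /= [pairwise _ _]hY andbT.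
by apply/allP => y /(mem_subseq sY)/root ->.
Qed.

Lemma hom_goal_large P m (t : bool -> nat) X :
  t true + t false = m -> sorted ltn X ->
  (forall x, x \in X -> 33 * m + 3 <= x) -> big [:: 33 * m] X ->
  hom_goal P t X.
Proof.
elim: m t X => [|m IH] t X tm so ge h; have hX := big_head h.
  exists true, [:: head 0 X]; split=> //; first by rewrite sub1seq.
  by have -> : t true = 0; [lia|constructor; constructor].
have [/existsP [c /eqP tc]|] := boolP [exists c, t c == 0].
  exists c, [:: head 0 X]; split=> //; first by rewrite sub1seq.
  by rewrite tc; constructor; constructor.
rewrite negb_exists => /forallP tpos.
have {}tpos c : 0 < t c by rewrite lt0n.
have [n en] : exists n, n = 33 * m by exists (33 * m).
have {}IH t' B : t' true + t' false = m -> subseq B X -> big [:: n] B ->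
    hom_goal P t' B.
  rewrite en => tm' sB hB; apply: IH => //; first exact: sorted_subseq sB so.
  by move=> x /(mem_subseq sB)/ge; apply: leq_trans; lia.
(* The 33 exponents: one extracts [a], 8 make it a root, and two groupings cost 12 each. *)
have {}h : big [:: (n + 24 + 8).+1] X by congr (big [:: _] X): h; lia.
have [X0 [a [Y [eX hY]]]] := big_succP h.
have sX : subseq (a :: Y) X by rewrite eX suffix_subseq.
have ga : n + 36 <= a by have := ge a; rewrite (mem_subseq sX) ?inE ?eqxx //; lia.
have a3 : 3 <= a.+1 by lia.
have an : n + 12 <= a.+1 by lia.
have aM : a <= 2 ^ (2 * a.+1) by have := ltn_expl (2 * a.+1) (leqnn 2); lia.
have above v : a < v -> [/\ 3 <= v.+1, n <= v.+1 & a + v <= 2 * v.+1].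
  by split; lia.
have saY : sorted ltn (a :: Y) := sorted_subseq sX so.
have soY : sorted ltn Y := path_sorted saY.
have gY y : y \in Y -> a < y.
  by move: saY; rewrite /= (path_sortedE ltn_trans) => /andP [/allP gY _] /gY.
have {}hY : big [:: n + 24 + 8] Y by apply: (big_nseq_le (k := 1) _ hY); lia.
have [||Y1 [sY1 hY1 cY1]] := @big_constant_tower unit (fun _ => P a)
  (n + 24) a.+1 [:: tt] Y isT _ _ soY gY hY; first by lia.
  by rewrite expn_gt0.
pose c := P a (head 0 Y1).
have ac y : y \in Y1 -> P a y = c.
  by move=> yY1; apply: (cY1 tt) (big_head hY1); rewrite ?inE.
have so1 := sorted_subseq sY1 soY.
have g1 y : y \in Y1 -> a < y by move=> /(mem_subseq sY1)/gY.
have sX1 : subseq (a :: Y1) X by apply: subseq_trans sX; rewrite /= eqxx.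
have crossE Cs : pairwise (crossed P) Cs ->
    pairwise (fun B B' => cross P c B B' || cross P (~~ c) B B') Cs.
  by apply: sub_pairwise => B B'; rewrite /crossed; case: (c) => //=; rewrite orbC.
have [|Bs [sB subB hB pB]] := @grouping P (n + 12) a.+1 a Y1 a3 an aM so1 g1.
  by rewrite -addnA.
have rootc Cs : subseq (flatten Cs) Y1 -> size Cs = a ->
    (forall B, B \in Cs -> big [:: n] B) -> pairwise (cross P c) Cs ->
    hom_goal P t X.
  move=> sC szC hC pC; apply: (hom_goal_rooted IH tm (tpos c) _ szC hC pC).
    by apply: subseq_trans sX1; rewrite /= eqxx.
  by move=> y /(mem_subseq sC)/ac.
have [pc|[B [B' [sBB cBB]]]] := pairwise_orP (crossE _ pB).
  apply: (rootc Bs) => // B BB; apply: big_leq (hB _ BB).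
  move=> x /(mem_subseq (mem_subseq_flatten BB)) /(mem_subseq subB) /g1.
  exact: leq_ltn_trans.
have [BB BB'] : B \in Bs /\ B' \in Bs.
  by split; apply: (mem_subseq sBB); rewrite !inE eqxx ?orbT.
(* Since [B] lies below [B'] with cross colour [~~ c], its least point is a root of that colour over
   [B']. *)
pose a' := head 0 B.
have a'B : a' \in B := big_head (hB _ BB).
have sBBY : subseq (B ++ B') Y1.
  by apply: subseq_trans subB; have := subseq_flatten sBB; rewrite /= cats0.
have [_ so' lt'] := sorted_cat_lt (sorted_subseq sBBY so1).
have aa' : a < a'.
  by apply: g1; apply: (mem_subseq sBBY); rewrite mem_cat a'B.
have g' y : y \in B' -> a' < y by apply: lt'.
have [a'3 a'n a'M] := above _ aa'.
(* So many blocks are available because [a < a']; Ramsey then gives as many blocks as the matching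
   root requires. *)
have [|Cs [sC subC hC pC]] := @grouping P n a'.+1 (2 ^ (a + a')) B'
  a'3 a'n _ so' g' (hB _ BB'); first by rewrite leq_exp2l.
have sB'Y : subseq B' Y1 := subseq_trans (suffix_subseq _ _) sBBY.
have [|Ds sD] := @ramsey_pairwise _ (cross P c) a a' Cs; first by rewrite sC.
have hD D : D \in Ds -> big [:: n] D by move=> /(mem_subseq sD)/hC.
have subD : subseq (flatten Ds) B' := subseq_trans (subseq_flatten sD) subC.
case=> [[szD pD]|[szD pD]].
  by apply: (rootc Ds) => //; apply: subseq_trans subD sB'Y.
apply: (hom_goal_rooted (c := ~~ c) (a := a') IH tm (tpos _) _ szD hD).
- apply: subseq_trans (subseq_trans (subseq_cons _ _) sX1).
  apply: subseq_trans sBBY; rewrite -cat1s; apply: cat_subseq => //.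
  by rewrite sub1seq.
- have pD' := crossE _ (subseq_pairwise sD pC).
  have : pairwise [rel x y | (cross P c x y || cross P (~~ c) x y) &&
      ~~ cross P c x y] Ds by rewrite pairwise_relI pD' pD.
  by apply: sub_pairwise => x y /= /andP [/orP [->|]].
by move=> y /(mem_subseq subD) yB'; apply/eqP; apply: (allrelP cBB).
Qed.

(** * Return to exact largeness and the stated bound *)

Lemma pairwise_lt_in (r : rel nat) Y x y : sorted ltn Y -> pairwise r Y ->
  x \in Y -> y \in Y -> x < y -> r x y.
Proof.
rewrite (sorted_pairwise ltn_trans).
elim: Y => //= z Y IH /andP [/allP zY pY] /andP [/allP rY pr].
rewrite !inE => /orP [/eqP ->|xY] /orP [/eqP ->|yY]; rewrite ?ltnn //.
- by move=> _; apply: rY.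
- by have := zY _ xY => /= h1 h2; have := ltn_trans h1 h2; rewrite ltnn.
- exact: IH.
Qed.

Theorem theorem1p6 (n : nat) (X : seq nat) :
  fin_set X ->
  (forall x, x \in X -> 3 <= x) ->
  large (omega_pow (300 * n)) X ->
  RT22_large (omega_pow n) X.
Proof.
move=> so ge /(@large_big [:: 300 * n]) h P.
suff [c [Y [sY bY hY]]] : hom_goal P (fun=> n) X.
  have [Z sZ lZ] := big_large bY.
  have sZX := subseq_trans sZ sY.
  exists Z; split=> //; [exact: sorted_subseq sZX so|exact: mem_subseq|].
  exists c => x y xZ yZ xy; apply/eqP.
  apply: (@pairwise_lt_in (fun x y => P x y == c) Z) => //.
    exact: sorted_subseq sZX so.
  exact: subseq_pairwise sZ hY.
case: n h => [|n] h.
  have bX := big_head h; exists true, [:: head 0 X]; split=> //.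
    by rewrite sub1seq.
  by constructor; constructor.
have X0 x : x \in X -> 0 < x by move=> /ge; lia.
pose N := 33 * (n.+1 + n.+1).
have {}h : big [:: N.+2] X.
  apply: (big_leq (k := 300 * n.+1 - N.+2) X0).
  by congr (big [:: _] X): h; lia.
(* Points are at least 3, so two terms [N.+1] are available. The first gives [Y] more than [N.+1]
   points, lifting all of [Z] to at least [N + 3]; the second makes [Z] large. *)
have := big_nseq_le (k := 2) (l := 1 * 3) isT (big_nseq_succ (k := 1) ge h).
move=> /(big_catP (s := [:: N.+1])) [Y [Z [eX hY hZ]]].
rewrite eX in so ge X0 *.
have [|||c [W [sW bW hW]]] := @hom_goal_large P (n.+1 + n.+1)
  (fun=> n.+1) Z erefl _ _ _.
- by have [] := sorted_cat_lt so.
- have Y0 y : y \in Y -> 0 < y by move=> yY; apply: X0; rewrite mem_cat yY.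
  move=> z /(sorted_cat_ge so ge); apply: leq_trans.
  by rewrite addnC leq_add2l; exact: ltnW (ltnW (size_big1 Y0 hY)).
- apply: (@big_leq N 1); last by rewrite addn1.
  by move=> z zZ; apply: X0; rewrite mem_cat zZ orbT.
exists c, W; split=> //; exact: subseq_trans sW (suffix_subseq _ _).
Qed.
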